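(* Let $\rho$ be a state in a convex resource theory with free set $\mathcal F$. Then $\sup_{\{p_i,\mathcal N_i\},\{A_i\},\{B_i\}}\ \frac{p_{\mathrm{succ}}(\rho,\{p_i,\mathcal N_i\},\{A_i\})\,/\,p_{\mathrm{succ}}(\rho,\{p_i,\mathcal N_i\},\{B_i\})}{\max_{\sigma\in\mathcal F}\ p_{\mathrm{succ}}(\sigma,\{p_i,\mathcal N_i\},\{A_i\})\,/\,p_{\mathrm{succ}}(\sigma,\{p_i,\mathcal N_i\},\{B_i\})}=\Omega_{\mathcal F}(\rho)$, where the supremum is over all finite channel ensembles $\{p_i,\mathcal N_i\}_{i=1}^n$ (probabilities $p_i$ and quantum channels $\mathcal N_i$ acting on the space of $\rho$) and all POVMs $\{A_i\}_{i=1}^n$, $\{B_i\}_{i=1}^n$ for which the expression is well defined.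
   Context: Finite dimensions; $A\le B$ means $B-A\ge0$. $\mathcal F$ is a closed convex set of free density operators. $R_{\max}(X\|Y)=\inf\{\lambda:X\le\lambda Y\}$ ($\inf\emptyset=\infty$); $\Omega_{\mathcal F}(\rho)=\inf_{\sigma\in\mathcal F}R_{\max}(\rho\|\sigma)R_{\max}(\sigma\|\rho)$. For a state $\omega$, a channel ensemble $\{p_i,\mathcal N_i\}$ and a POVM $\{A_i\}$, $p_{\mathrm{succ}}(\omega,\{p_i,\mathcal N_i\},\{A_i\})=\sum_i p_i\,\mathrm{Tr}[\mathcal N_i(\omega)A_i]$. *)

(* Defs.v *)
From HB Require Import structures.
From mathcomp Require Import all_boot all_order all_algebra.
From mathcomp Require Import complex.
From mathcomp Require Import all_classical all_reals.
From mathcomp Require Import ereal topology normedtype sequences.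

Set Implicit Arguments.
Unset Strict Implicit.
Unset Printing Implicit Defensive.

Import Order.TTheory GRing.Theory Num.Theory numFieldNormedType.Exports.
Local Open Scope classical_set_scope.
Local Open Scope ring_scope.
Local Open Scope complex_scope.

Section QuantumDefs.
Variable R : realType.
Local Notation C := R[i].

Definition adj (m n : nat) (A : 'M[C]_(m, n)) : 'M[C]_(n, m) :=
  (map_mx (@conjc R) A)^T.

(* positive semidefiniteness: v^* A v >= 0 for every vector v
   (in the order of C, 0 <= z means z is real and nonnegative). *)
Definition psd (n : nat) (A : 'M[C]_n) : Prop :=
  forall v : 'cV[C]_n, 0 <= (adj v *m A *m v) 0 0.

Definition loewner_le (n : nat) (A B : 'M[C]_n) : Prop := psd (B - A).

Definition is_state (n : nat) (rho : 'M[C]_n) : Prop :=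
  psd rho /\ \tr rho = 1.

(* Positivity of a k x k block matrix with blocks X a b : 'M_n, written out:
   the block matrix [X a b]_{a,b} is PSD iff
   sum_{a,b} (v a)^* (X a b) (v b) >= 0 for all families of vectors v. *)
Definition block_psd (k n : nat) (X : 'I_k -> 'I_k -> 'M[C]_n) : Prop :=
  forall v : 'I_k -> 'cV[C]_n,
    0 <= (\sum_(a < k) \sum_(b < k) (adj (v a) *m X a b *m v b)) 0 0.

(* complete positivity: N (x) id_k is positive for every k *)
Definition completely_positive (n m : nat) (N : 'M[C]_n -> 'M[C]_m) : Prop :=
  forall (k : nat) (X : 'I_k -> 'I_k -> 'M[C]_n),
    block_psd X -> block_psd (fun a b => N (X a b)).

Definition trace_preserving (n m : nat) (N : 'M[C]_n -> 'M[C]_m) : Prop :=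
  forall X : 'M[C]_n, \tr (N X) = \tr X.

Definition is_channel (n m : nat) (N : 'M[C]_n -> 'M[C]_m) : Prop :=
  linear N /\ completely_positive N /\ trace_preserving N.

Definition is_prob (k : nat) (p : 'I_k -> R) : Prop :=
  (forall i, 0 <= p i) /\ \sum_(i < k) p i = 1.

Definition is_POVM (k m : nat) (A : 'I_k -> 'M[C]_m) : Prop :=
  (forall i, psd (A i)) /\ \sum_(i < k) A i = 1%:M.

(* p_succ(omega, {p_i, N_i}, {A_i}) = sum_i p_i Tr[N_i(omega) A_i]
   (a real number; we take the real part of the trace, which is real). *)
Definition psucc (n m k : nat) (omega : 'M[C]_n) (p : 'I_k -> R)
    (N : 'I_k -> 'M[C]_n -> 'M[C]_m) (A : 'I_k -> 'M[C]_m) : R :=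
  \sum_(i < k) p i * complex.Re (\tr (N i omega *m A i)).

(* R_max(X||Y) = inf { lambda in R : X <= lambda Y }, inf of empty = +oo *)
Definition Rmax (n : nat) (X Y : 'M[C]_n) : \bar R :=
  ereal_inf [set (l%:E)%E | l in [set l : R | loewner_le X (l%:C *: Y)]].

Definition Omega (n : nat) (F : set 'M[C]_n) (rho : 'M[C]_n) : \bar R :=
  ereal_inf [set (Rmax rho s * Rmax s rho)%E | s in F].

Definition convex_set (n : nat) (F : set 'M[C]_n) : Prop :=
  forall x y, F x -> F y -> forall t : R, 0 <= t -> t <= 1 ->
    F (t%:C *: x + (1 - t)%:C *: y).

(* closedness in the Euclidean topology of M_n(C): F contains the entrywise
   limits (real and imaginary parts) of its convergent sequences *)
Definition closed_set (n : nat) (F : set 'M[C]_n) : Prop :=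
  forall (s : nat -> 'M[C]_n) (X : 'M[C]_n),
    (forall k, F (s k)) ->
    (forall i j, (fun k => complex.Re (s k i j)) @ \oo --> complex.Re (X i j)) ->
    (forall i j, (fun k => complex.Im (s k i j)) @ \oo --> complex.Im (X i j)) ->
    F X.

Definition free_set (n : nat) (F : set 'M[C]_n) : Prop :=
  (forall s, F s -> is_state s) /\ convex_set F /\ closed_set F /\ F !=set0.

(* The set of values of the ratio-of-ratios
     [p(rho,A)/p(rho,B)] / [max_{sigma in F} p(sigma,A)/p(sigma,B)]
   over all finite channel ensembles {p_i, N_i}_{i<k} (channels from M_n to
   M_m for an arbitrary output dimension m) and POVMs {A_i}, {B_i} on M_m,
   for which the expression is well defined: all divisions are by nonzero
   numbers and the maximum over F is attained. *)
Definition discrimination_ratios (n : nat) (F : set 'M[C]_n) (rho : 'M[C]_n)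
    : set R :=
  [set x | exists (m k : nat) (p : 'I_k -> R)
             (N : 'I_k -> 'M[C]_n -> 'M[C]_m) (A B : 'I_k -> 'M[C]_m),
     [/\ is_prob p, (forall i, is_channel (N i)), is_POVM A, is_POVM B &
     let ratio := fun w => psucc w p N A / psucc w p N B in
     [/\ psucc rho p N B != 0,
         (forall s, F s -> psucc s p N B != 0) &
         exists2 s0, F s0 /\ (forall s, F s -> ratio s <= ratio s0) &
           ratio s0 != 0 /\ x = ratio rho / ratio s0]]].

End QuantumDefs.

(* Main.v *)
(** Upper bound: if [rho <= l s] and [s <= mu rho] with [s] free, then the success
    probabilities satisfy [p(rho,A) <= l p(s,A)] and [p(s,B) <= mu p(rho,B)], so
    every ratio is at most [l mu].
    Lower bound: [Omega <= c] holds as soon as [rho <= t s <= c rho] for some [t >= 0]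
    and [s] free, i.e. as soon as [(-rho, c rho)] lies in the closed convex cone of
    pairs [(P - t s, Q + t s)] with [P, Q >= 0].  If [c < Omega], a hyperplane
    separating this point from the cone is a pair [A, B >= 0] with
    [tr (s A) <= tr (s B)] on the free set and [tr (rho A) > c tr (rho B)].  After
    adding a small multiple of the identity and rescaling, [A] and [B] are the first
    effects of two binary POVMs, and the ensemble that always applies the identity
    channel and rewards only the first outcome has a ratio larger than [c]. *)
Require Import Defs.
From HB Require Import structures.
From mathcomp Require Import all_boot all_order all_algebra.
From mathcomp Require Import complex spectral.
From mathcomp Require Import all_classical all_reals.
From mathcomp Require Import ereal topology normedtype sequences.
From mathcomp Require Import ring lra.

Set Implicit Arguments.
Unset Strict Implicit.
Unset Printing Implicit Defensive.

Import Order.TTheory GRing.Theory Num.Theory numFieldNormedType.Exports.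
Local Open Scope classical_set_scope.
Local Open Scope ring_scope.
Local Open Scope complex_scope.

(** * Compactness and separation from a closed convex cone in a real Euclidean space *)

Section RealCones.
Variables (R : realType) (T : finType).
Implicit Types (x y v l : T -> R) (u : nat -> T -> R).

(** Bolzano-Weierstrass, by a cluster point of the sequence in a compact box. The index map [phi]
    need not be increasing: [k <= phi k] already sends it to infinity. *)
Lemma bounded_cvg_subseq u (M : R) :
  (forall k t, `|u k t| <= M) ->
  exists (phi : nat -> nat) (l : T -> R),
    (forall k, (k <= phi k)%N) /\ forall t, u (phi k) t @[k --> \oo] --> l t.
Proof.
move=> uM.
pose w k : 'rV[R]_#|T| := \row_i u k (enum_val i).
have wM : (w @ \oo) [set v : 'rV[R]_#|T| | forall i, `[-M, M]%classic (v ord0 i)].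
  by exists 0 => // k _ /= i; rewrite in_itv /= mxE -ler_norml; exact: uM.
have [p [_ clp]] := @rV_compact R #|T| (fun=> `[-M, M]%classic)
  (fun=> @segment_compact R (-M) M) (w @ \oo) _ wM.
have near_p k : exists j, (k <= j)%N /\
    forall t, `|p ord0 (enum_rank t) - u j t| < k.+1%:R^-1.
  have [] := clp [set w j | j in [set j | (k <= j)%N]] (ball p k.+1%:R^-1).
  - by exists k => // j /= kj; exists j.
  - by apply: nbhsx_ballx; rewrite invr_gt0.
  move=> _ [[j kj <-]] pj; exists j; split=> // t.
  by have := pj.2 ord0 (enum_rank t); rewrite mxE enum_rankK.
have [phi phiP] := choice near_p.
exists phi, (fun t => p ord0 (enum_rank t)); split=> [k|t].
  by have [] := phiP k.
apply/cvgrPdist_lt => e e0.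
have : n.+1%:R^-1 @[n --> \oo] --> (0 : R) by exact: cvg_harmonic.
move=> /cvgrPdist_lt /(_ e e0); apply: filterS => k /= ke.
have [_ /(_ t) pk] := phiP k; apply: lt_trans pk _.
by move: ke; rewrite sub0r normrN ger0_norm // invr_ge0.
Qed.

(** First-order optimality condition: for small [s] the linear term dominates the quadratic one. *)
Lemma linear_term_ge0 (a b : R) : 0 <= b ->
  (forall s, 0 < s -> s <= 1 -> 0 <= s * a *+ 2 + s ^+ 2 * b) -> 0 <= a.
Proof.
move=> b0 H; rewrite leNgt; apply/negP => a0.
have d0 : 0 < b - a + 1 by lra.
(* This denominator gives both [s <= 1] and [s * b < - a], so that [s * (2 a + s b) < s * a < 0]. *)
pose s := - a / (b - a + 1).
have s0 : 0 < s by rewrite /s divr_gt0 //; lra.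
have sE : s * (b - a + 1) = - a by rewrite /s mulfVK // gt_eqF.
have s1 : s <= 1 by nra.
have := H s s0 s1; nra.
Qed.

Lemma cvg_sumr (f : nat -> T -> R) l :
  (forall t, f k t @[k --> \oo] --> l t) ->
  \sum_t f k t @[k --> \oo] --> \sum_t l t.
Proof.
move=> fl; elim: (index_enum T) => [|t r IH].
  by rewrite big_nil; under eq_fun do rewrite big_nil; exact: cvg_cst.
rewrite big_cons; under eq_fun do rewrite big_cons.
by apply: cvgD.
Qed.

(* The separating functional is [l - v], with [l] the point of [K] closest to [v]. *)
Lemma cone_separation (K : set (T -> R)) v :
  K (fun=> 0) ->
  (forall x y, K x -> K y -> K (fun t => x t + y t)) ->
  (forall (a : R) x, 0 <= a -> K x -> K (fun t => a * x t)) ->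
  (forall u l, (forall k, K (u k)) ->
    (forall t, u k t @[k --> \oo] --> l t) -> K l) ->
  ~ K v ->
  exists y, (forall x, K x -> 0 <= \sum_t y t * x t) /\ \sum_t y t * v t < 0.
Proof.
move=> K0 KD KZ Kcl Kv.
pose N x := \sum_t (x t - v t) ^+ 2.
have N_ge0 x : 0 <= N x by apply: sumr_ge0 => t _; exact: sqr_ge0.
pose S : set R := [set N x | x in K].
have S_inf : has_inf S.
  by split; [exists (N (fun=> 0)), (fun=> 0) | exists 0 => _ [x _ <-]].
have near_inf k : exists x, K x /\ N x < inf S + k.+1%:R^-1.
  have k_gt0 : 0 < k.+1%:R^-1 :> R by rewrite invr_gt0.
  by have [_ [x Kx <-] xlt] := inf_adherent k_gt0 S_inf; exists x.
have [u uP] := choice near_inf.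
have S_ge0 : 0 <= inf S by apply: lb_le_inf; [case: S_inf|move=> _ [x _ <-]].
(* A minimising sequence is bounded: each squared deviation from [v] is at most [inf S + 1], and
   [2 r <= r ^+ 2 + 1] turns this into a bound on the deviation itself. *)
have [|phi [l [phik lP]]] := @bounded_cvg_subseq u (inf S + 2 + \sum_t `|v t|).
  move=> k t; have [_ uk] := uP k.
  have k1 : k.+1%:R^-1 <= 1 :> R by rewrite invf_le1 // ler1n.
  have ut : (u k t - v t) ^+ 2 <= N (u k).
    by rewrite /N (bigD1 t) //= lerDl sumr_ge0 // => s _; exact: sqr_ge0.
  have vt : `|v t| <= \sum_s `|v s|.
    by rewrite (bigD1 t) //= lerDl sumr_ge0.
  have {}ut : `|u k t - v t| <= inf S + 2.
    have : `|u k t - v t| ^+ 2 <= inf S + 1.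
      rewrite real_normK ?num_real //; apply: le_trans ut _.
      by apply: le_trans (ltW uk) _; rewrite lerD2l.
    by have := sqr_ge0 (`|u k t - v t| - 1); rewrite sqrrB1; lra.
  rewrite -[u k t](subrK (v t)); apply: le_trans (ler_normD _ _) _.
  exact: lerD.
have Kl : K l by apply: Kcl lP => k; case: (uP (phi k)).
have Nl : N l <= inf S.
  have N_cvg : N (u (phi k)) @[k --> \oo] --> N l.
    have uv_cvg t : u (phi k) t - v t @[k --> \oo] --> l t - v t.
      by apply: cvgB; [exact: lP | exact: cvg_cst].
    by apply: cvg_sumr => t; apply: cvgM.
  have b_cvg : inf S + k.+1%:R^-1 @[k --> \oo] --> inf S + 0.
    by apply: cvgD; [exact: cvg_cst | exact: cvg_harmonic].
  rewrite -[leRHS]addr0; apply: ler_cvg_to N_cvg b_cvg _.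
  apply: nearW => k; have [_ /ltW uk] := uP (phi k).
  apply: le_trans uk _; rewrite lerD2l lef_pV2 ?posrE ?ltr0n //.
  by rewrite ler_nat ltnS.
have Nmin x : K x -> N l <= N x.
  by move=> Kx; apply: le_trans Nl _; apply: ge_inf; [case: S_inf | exists x].
have variation x (s : R) :
    N (fun t => l t + s * x t) =
    N l + (s * (\sum_t (l t - v t) * x t) *+ 2 + s ^+ 2 * \sum_t x t ^+ 2).
  rewrite /N !mulr_sumr -sumrMnl -!big_split /=.
  by apply: eq_bigr => t _; ring.
have sq_ge0 x : 0 <= \sum_t x t ^+ 2.
  by apply: sumr_ge0 => t _; exact: sqr_ge0.
exists (fun t => l t - v t); split=> [x Kx|].
  apply: (linear_term_ge0 (sq_ge0 x)) => s s0 _.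
  rewrite -(lerD2l (N l)) addr0 -variation; apply: Nmin.
  by apply: KD => //; apply: KZ => //; exact: ltW.
(* Moving from [l] towards the origin stays in [K] only for steps [s <= 1], where [(1 - s) l] is
   still a nonnegative multiple of [l]. *)
have l_le0 : \sum_t (l t - v t) * l t <= 0.
  rewrite -oppr_ge0 -sumrN; under eq_bigr do rewrite -mulrN.
  apply: (linear_term_ge0 (sq_ge0 (fun t => - l t))) => s s0 s1.
  rewrite -(lerD2l (N l)) addr0 -variation; apply: Nmin.
  rewrite (_ : (fun _ => _) = fun t => (1 - s) * l t); last first.
    by apply/funext => t; ring.
  by apply: KZ => //; lra.
have Nl_gt0 : 0 < N l.
  rewrite lt_def N_ge0 andbT; apply/negP => /eqP Nl0; apply: Kv.
  suff -> : v = l by [].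
  apply/funext => t; apply/eqP; rewrite eq_sym -subr_eq0 -sqrf_eq0.
  move/eqP: Nl0; rewrite psumr_eq0; last by move=> s _; exact: sqr_ge0.
  by move=> /allP /(_ t); rewrite mem_index_enum => /(_ isT).
suff -> : \sum_t (l t - v t) * v t = \sum_t (l t - v t) * l t - N l by lra.
rewrite /N -sumrB; apply: eq_bigr => t _; ring.
Qed.

End RealCones.

(** * Positive semidefinite matrices and traces of their products *)

Section Positivity.
Variable R : realType.
Local Notation C := R[i].
Local Notation Re := (@complex.Re R).
Local Notation Im := (@complex.Im R).

Lemma ge0cE (z : C) : (0 <= z) = (Im z == 0) && (0 <= Re z).
Proof. by rewrite lecE. Qed.

Lemma ReD (z w : C) : Re (z + w) = Re z + Re w.
Proof. by case: z w => [a b] [c d]. Qed.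

Lemma ReN (z : C) : Re (- z) = - Re z.
Proof. by case: z. Qed.

Lemma ReZ (a : R) (z : C) : Re (a%:C * z) = a * Re z.
Proof. by case: z => b c /=; rewrite mul0r subr0. Qed.

Lemma Re_sum (I : Type) (r : seq I) (P : pred I) (f : I -> C) :
  Re (\sum_(i <- r | P i) f i) = \sum_(i <- r | P i) Re (f i).
Proof. by apply: (big_morph Re ReD). Qed.

Lemma adjE m n (A : 'M[C]_(m, n)) : adj A = map_mx Num.conj A^T.
Proof. by apply/matrixP => i j; rewrite !mxE. Qed.

Lemma adjD m n (A B : 'M[C]_(m, n)) : adj (A + B) = adj A + adj B.
Proof. by rewrite /adj map_mxD linearD. Qed.

Lemma adjZ m n (z : C) (A : 'M[C]_(m, n)) : adj (z *: A) = z^* *: adj A.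
Proof. by rewrite /adj map_mxZ linearZ. Qed.

Lemma adj_delta m n i j : adj (delta_mx i j : 'M[C]_(m, n)) = delta_mx j i.
Proof. by rewrite /adj map_delta_mx trmx_delta. Qed.

Lemma adjK m n (A : 'M[C]_(m, n)) : adj (adj A) = A.
Proof. by apply/matrixP => i j; rewrite !mxE conjcK. Qed.

Lemma adjM m n p (A : 'M[C]_(m, n)) (B : 'M[C]_(n, p)) :
  adj (A *m B) = adj B *m adj A.
Proof. by rewrite /adj map_mxM trmx_mul. Qed.

Lemma quad_tr n (A : 'M[C]_n) (v : 'cV[C]_n) :
  (adj v *m A *m v) 0 0 = \tr (A *m (v *m adj v)).
Proof. by rewrite -trace_mx11 -mulmxA mxtrace_mulC mulmxA. Qed.

(** Polarisation: the choices [z = 1, -1, 'i, - 'i] isolate the real and imaginary parts of the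
    entries. *)
Lemma quad_basis n (A : 'M[C]_n) i j (z : C) :
  let v := delta_mx i 0 + z *: delta_mx j 0 : 'cV[C]_n in
  (adj v *m A *m v) 0 0 =
    A i i + z * A i j + (z^* * A j i + z^* * z * A j j).
Proof.
move=> v; rewrite /v adjD adjZ !adj_delta !mulmxDl !mulmxDr.
rewrite -!scalemxAl -!scalemxAr -!rowE -!colE !mxE; ring.
Qed.

Lemma psd0 n : psd (0 : 'M[C]_n).
Proof. by move=> v; rewrite mulmx0 mul0mx mxE. Qed.

Lemma psdD n (A B : 'M[C]_n) : psd A -> psd B -> psd (A + B).
Proof. by move=> pA pB v; rewrite mulmxDr mulmxDl mxE addr_ge0. Qed.

Lemma psdZ n (a : R) (A : 'M[C]_n) : 0 <= a -> psd A -> psd (a%:C *: A).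
Proof.
by move=> a0 pA v; rewrite -scalemxAr -scalemxAl mxE mulr_ge0 // ler0c.
Qed.

Lemma quad1_ge0 n (v : 'cV[C]_n) : 0 <= (adj v *m v) 0 0.
Proof.
rewrite mxE; apply: sumr_ge0 => i _; rewrite !mxE mulrC; exact: mulcJ_ge0.
Qed.

Lemma psd1 n : psd (1%:M : 'M[C]_n).
Proof. by move=> v; rewrite mulmx1; exact: quad1_ge0. Qed.

Lemma psd_congr m n (A : 'M[C]_n) (B : 'M[C]_(n, m)) :
  psd A -> psd (adj B *m A *m B).
Proof.
by move=> pA v; have := pA (B *m v); rewrite adjM !mulmxA.
Qed.

Lemma psd_outer n (v : 'cV[C]_n) : psd (v *m adj v).
Proof.
by have := psd_congr (adj v) (@psd1 1); rewrite mulmx1 adjK.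
Qed.

Lemma psd_diag_ge0 n (A : 'M[C]_n) i : psd A -> 0 <= A i i.
Proof.
by move=> /(_ (delta_mx i 0)); rewrite adj_delta -rowE -colE !mxE.
Qed.

Lemma psd_tr_ge0 n (A : 'M[C]_n) : psd A -> 0 <= \tr A.
Proof. by move=> pA; apply: sumr_ge0 => i _; exact: psd_diag_ge0. Qed.

(** Nonnegativity in [C] forces the quadratic form to be real; reality at [z = 1] and [z = 'i]
    relates [A i j] to [A j i]. *)
Lemma psd_hermitian n (A : 'M[C]_n) : psd A -> adj A = A.
Proof.
move=> pA; apply/matrixP => i j; rewrite !mxE.
have := psd_diag_ge0 i pA; have := psd_diag_ge0 j pA.
have := pA (delta_mx i 0 + 1 *: delta_mx j 0); rewrite quad_basis.
have := pA (delta_mx i 0 + 'i *: delta_mx j 0); rewrite quad_basis.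
case: (A i j) (A j i) (A i i) (A j j) => [a b] [c d] [e f] [g h].
rewrite !ge0cE /= => /andP[/eqP H1 _] /andP[/eqP H2 _].
move=> /andP[/eqP H3 _] /andP[/eqP H4 _].
by congr Complex; lra.
Qed.

(** The four polarised forms bound each part of an entry by the mean of [A i i] and [A j j]. This
    makes the set of states bounded. *)
Lemma psd_entry_bound n (A : 'M[C]_n) i j : psd A ->
  `|Re (A i j)| <= Re (\tr A) /\ `|Im (A i j)| <= Re (\tr A).
Proof.
move=> pA.
have diag_le k : Re (A k k) <= Re (\tr A).
  rewrite /mxtrace (bigD1 k) //= ReD lerDl Re_sum sumr_ge0 // => l _.
  by have := psd_diag_ge0 l pA; rewrite ge0cE => /andP[].
have := diag_le i; have := diag_le j.
have /matrixP /(_ i j) := psd_hermitian pA; rewrite !mxE.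
have := pA (delta_mx i 0 + 1 *: delta_mx j 0); rewrite quad_basis.
have := pA (delta_mx i 0 + (-1) *: delta_mx j 0); rewrite quad_basis.
have := pA (delta_mx i 0 + 'i *: delta_mx j 0); rewrite quad_basis.
have := pA (delta_mx i 0 + (- 'i) *: delta_mx j 0); rewrite quad_basis.
move: (Re (\tr A)) => t.
case: (A i j) (A j i) (A i i) (A j j) => [a b] [c d] [e f] [g h].
rewrite !ge0cE /= => /andP[_ H1] /andP[_ H2] /andP[_ H3] /andP[_ H4].
case=> H5 H6 H7 H8; rewrite !ler_norml; split; lra.
Qed.

(** In an eigenbasis of [A] the trace of the product is the sum of the eigenvalues weighted by the
    diagonal of the rotated [X]; all these numbers are nonnegative, and each eigenvalue is at most
    their sum. *)
Lemma psd_tr_mul n (X A : 'M[C]_n) : psd X -> psd A ->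
  0 <= \tr (X *m A) <= \tr X * \tr A.
Proof.
move=> pX pA.
have A_herm : A \is hermsymmx.
  by apply/is_hermitianmxP; rewrite expr0 scale1r -adjE psd_hermitian.
set P := spectralmx A; set D := spectral_diag A.
have P_unitary : P \is unitarymx := spectral_unitarymx A.
have AE : A = adj P *m diag_mx D *m P.
  by rewrite {1}(orthomx_spectralP (hermitian_normalmx A_herm))
             invmx_unitary // adjE.
have PPa : P *m adj P = 1%:M by rewrite adjE; exact/unitarymxP.
have aPP : adj P *m P = 1%:M by exact: mulmx1C.
have DE : diag_mx D = P *m A *m adj P.
  by rewrite AE !mulmxA PPa mul1mx -mulmxA PPa mulmx1.
have D_ge0 i : 0 <= D 0 i.
  have : psd (P *m A *m adj P) by have := psd_congr (adj P) pA; rewrite adjK.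
  by move=> /(psd_diag_ge0 i); rewrite -DE !mxE eqxx.
pose Y := P *m X *m adj P.
have Y_ge0 i : 0 <= Y i i.
  by apply: psd_diag_ge0; have := psd_congr (adj P) pX; rewrite adjK.
have trY : \tr X = \sum_i Y i i.
  by rewrite -[RHS]/(\tr Y) /Y -mulmxA mxtrace_mulC -mulmxA aPP mulmx1.
have trD : \tr A = \sum_i D 0 i.
  by rewrite AE -mulmxA mxtrace_mulC -mulmxA PPa mulmx1 mxtrace_diag.
have trYD : \tr (X *m A) = \sum_i Y i i * D 0 i.
  rewrite AE mulmxA mxtrace_mulC !mulmxA -[_ *m diag_mx D]/(Y *m diag_mx D).
  by apply: eq_bigr => i _; rewrite mul_mx_diag mxE.
rewrite trYD trY trD; apply/andP; split.
  by apply: sumr_ge0 => i _; exact: mulr_ge0.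
rewrite mulr_suml; apply: ler_sum => i _; apply: ler_wpM2l => //.
by rewrite (bigD1 i) //= lerDl sumr_ge0.
Qed.

End Positivity.

(** * The real trace pairing, limits of matrices, and separation for pairs of matrices *)

Section TracePairing.
Variable R : realType.
Local Notation C := R[i].
Local Notation Re := (@complex.Re R).
Local Notation Im := (@complex.Im R).

Definition retr n (X A : 'M[C]_n) : R := Re (\tr (X *m A)).

(** Real and imaginary parts are kept apart to match the hypotheses of [closed_set]. *)
Definition mx_cvg n (s : nat -> 'M[C]_n) (X : 'M[C]_n) : Prop :=
  (forall i j, Re (s k i j) @[k --> \oo] --> Re (X i j)) /\
  (forall i j, Im (s k i j) @[k --> \oo] --> Im (X i j)).

Lemma retrDl n (X Y A : 'M[C]_n) : retr (X + Y) A = retr X A + retr Y A.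
Proof. by rewrite /retr mulmxDl linearD ReD. Qed.

Lemma retrDr n (X A B : 'M[C]_n) : retr X (A + B) = retr X A + retr X B.
Proof. by rewrite /retr mulmxDr linearD ReD. Qed.

Lemma retrNl n (X A : 'M[C]_n) : retr (- X) A = - retr X A.
Proof. by rewrite /retr mulNmx linearN ReN. Qed.

Lemma retrZl n (a : R) (X A : 'M[C]_n) : retr (a%:C *: X) A = a * retr X A.
Proof. by rewrite /retr -scalemxAl linearZ /= ReZ. Qed.

Lemma retrZr n (a : R) (X A : 'M[C]_n) : retr X (a%:C *: A) = a * retr X A.
Proof. by rewrite /retr -scalemxAr linearZ /= ReZ. Qed.

Lemma retr_ge0 n (X A : 'M[C]_n) : psd X -> psd A -> 0 <= retr X A.
Proof.
by move=> pX pA; have /andP[+ _] := psd_tr_mul pX pA; rewrite ge0cE => /andP[].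
Qed.

Lemma retr1 n (X : 'M[C]_n) : retr X 1%:M = Re (\tr X).
Proof. by rewrite /retr mulmx1. Qed.

Lemma retr_state1 n (X : 'M[C]_n) : is_state X -> retr X 1%:M = 1.
Proof. by case=> _ trX; rewrite retr1 trX. Qed.

Lemma retrE n (X A : 'M[C]_n) :
  retr X A = \sum_(p : 'I_n * 'I_n)
    (Re (X p.1 p.2) * Re (A p.2 p.1) - Im (X p.1 p.2) * Im (A p.2 p.1)).
Proof.
rewrite /retr /mxtrace Re_sum.
rewrite -(pair_bigA _ (fun i j =>
  Re (X i j) * Re (A j i) - Im (X i j) * Im (A j i))) /=.
apply: eq_bigr => i _; rewrite mxE Re_sum; apply: eq_bigr => j _.
by case: (X i j) (A j i) => [a b] [c d].
Qed.

Lemma retr_cvg n (s : nat -> 'M[C]_n) X A :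
  mx_cvg s X -> retr (s k) A @[k --> \oo] --> retr X A.
Proof.
move=> [sRe sIm]; rewrite retrE; under eq_fun do rewrite retrE.
apply: cvg_sumr => p; apply: cvgB; apply: cvgM;
  by [exact: sRe | exact: sIm | exact: cvg_cst].
Qed.

Lemma cvg_subseq (f : nat -> R) (l : R) (phi : nat -> nat) :
  (forall k, (k <= phi k)%N) -> f k @[k --> \oo] --> l ->
  f (phi k) @[k --> \oo] --> l.
Proof.
move=> kphi fl; have phioo : phi k @[k --> \oo] --> \oo.
  apply/cvgnyPge => N; exists N => // k /= Nk; exact: leq_trans (kphi k).
exact: cvg_comp phioo fl.
Qed.

Lemma mx_cvg_subseq n (s : nat -> 'M[C]_n) X (phi : nat -> nat) :
  (forall k, (k <= phi k)%N) -> mx_cvg s X -> mx_cvg (fun k => s (phi k)) X.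
Proof.
move=> kphi [sRe sIm]; split=> i j.
  exact: (@cvg_subseq (fun k => Re (s k i j))).
exact: (@cvg_subseq (fun k => Im (s k i j))).
Qed.

Lemma mx_cvgD n (s s' : nat -> 'M[C]_n) X X' :
  mx_cvg s X -> mx_cvg s' X' -> mx_cvg (fun k => s k + s' k) (X + X').
Proof.
move=> [sRe sIm] [sRe' sIm']; split=> i j; rewrite mxE.
  by under eq_fun do rewrite mxE ReD; rewrite ReD; apply: cvgD.
have ImD (z w : C) : Im (z + w) = Im z + Im w by case: z w => [a b] [c d].
by under eq_fun do rewrite mxE ImD; rewrite ImD; apply: cvgD.
Qed.

Lemma mx_cvgZ n (a : nat -> R) (l : R) (s : nat -> 'M[C]_n) X :
  a k @[k --> \oo] --> l -> mx_cvg s X ->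
  mx_cvg (fun k => (a k)%:C *: s k) (l%:C *: X).
Proof.
move=> al [sRe sIm]; split=> i j; rewrite mxE.
  by under eq_fun do rewrite mxE ReZ; rewrite ReZ; apply: cvgM.
have ImZ (b : R) (z : C) : Im (b%:C * z) = b * Im z.
  by case: z => c d /=; rewrite mul0r addr0.
by under eq_fun do rewrite mxE ImZ; rewrite ImZ; apply: cvgM.
Qed.

Lemma mx_cvgN n (s : nat -> 'M[C]_n) X :
  mx_cvg s X -> mx_cvg (fun k => - s k) (- X).
Proof.
move=> sX; rewrite -scaleN1r (_ : -1 = (-1 : R)%:C); last first.
  by rewrite rmorphN1.
rewrite (_ : (fun k => - s k) = (fun k => (-1 : R)%:C *: s k)).
  by apply: mx_cvgZ sX; exact: cvg_cst.
by apply/funext => k; rewrite rmorphN1 scaleN1r.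
Qed.

Lemma psd_closed n (s : nat -> 'M[C]_n) X :
  (forall k, psd (s k)) -> mx_cvg s X -> psd X.
Proof.
move=> s_psd sX v.
have ReE Y : Re ((adj v *m Y *m v) 0 0) = retr Y (v *m adj v).
  by rewrite quad_tr.
(* The factor [- 'i] moves the imaginary part into the real part, so both parts of the quadratic
   form are pairings and pass to the limit by [retr_cvg]. *)
have ImE Y : Im ((adj v *m Y *m v) 0 0) = retr Y (- 'i *: (v *m adj v)).
  rewrite quad_tr /retr -scalemxAr linearZ /=.
  by case: (\tr _) => a b /=; ring.
rewrite ge0cE ReE ImE; apply/andP; split; last first.
  apply: cvgr_to_ge (retr_cvg sX) _; apply: nearW => k.
  by have := s_psd k v; rewrite ge0cE ReE => /andP[].
have ImX := retr_cvg (A := - 'i *: (v *m adj v)) sX.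
have s0 k : retr (s k) (- 'i *: (v *m adj v)) = 0.
  by have := s_psd k v; rewrite ge0cE ImE => /andP[/eqP].
rewrite eq_le; apply/andP; split.
  by apply: cvgr_to_le ImX _; apply: nearW => k; rewrite s0.
by apply: cvgr_to_ge ImX _; apply: nearW => k; rewrite s0.
Qed.

Lemma states_cvg_subseq n (s : nat -> 'M[C]_n) :
  (forall k, is_state (s k)) ->
  exists (phi : nat -> nat) X,
    (forall k, (k <= phi k)%N) /\ mx_cvg (fun k => s (phi k)) X.
Proof.
move=> s_state.
pose u k (t : bool * 'I_n * 'I_n) : R :=
  (if t.1.1 then Re else Im) (s k t.1.2 t.2).
have [|phi [l [kphi ul]]] := @bounded_cvg_subseq _ _ u 1.
  move=> k [[b i] j]; have [pk trk] := s_state k.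
  have := psd_entry_bound i j pk; rewrite trk /u /=.
  by case: b => /= -[].
exists phi, (\matrix_(i, j) (l (true, i, j) +i* l (false, i, j))).
split=> //; split=> i j; rewrite mxE /=.
  exact: (ul (true, i, j)).
exact: (ul (false, i, j)).
Qed.

(** Self-duality of the positive cone. A functional that is nonnegative on it may be represented by
    a non-Hermitian matrix, but [(A + adj A) / 2] has the same pairing with every Hermitian matrix,
    and its quadratic form is real. *)
Lemma hermitian_part n (A : 'M[C]_n) :
  (forall P, psd P -> 0 <= retr P A) ->
  exists A', psd A' /\ forall X, psd X -> retr X A' = retr X A.
Proof.
move=> A_ge0; pose A' := (2^-1 : R)%:C *: (A + adj A).
have tr_adj (M : 'M[C]_n) : \tr (adj M) = (\tr M)^*.
  by rewrite /adj mxtrace_tr [RHS]rmorph_sum; apply: eq_bigr => i _; rewrite mxE.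
have trA' X : psd X -> \tr (X *m A') = (retr X A)%:C.
  move=> pX; rewrite /A' -scalemxAr linearZ /= mulmxDr linearD /=.
  rewrite -{2}(psd_hermitian pX) -adjM tr_adj [\tr (A *m X)]mxtrace_mulC.
  rewrite /retr; case: (\tr _) => a b; apply/eqP.
  by rewrite eq_complex /=; apply/andP; split; apply/eqP; field.
exists A'; split=> [v|X pX]; last by rewrite {1}/retr trA'.
rewrite quad_tr mxtrace_mulC trA' ?ler0c; last exact: psd_outer.
exact/A_ge0/psd_outer.
Qed.

(** A pair of complex matrices is encoded as one real vector indexed by component, real or imaginary
    part, and entry; [cone_separation] applies there. *)
Lemma mx_cone_separation n (K : 'M[C]_n -> 'M[C]_n -> Prop) V W :
  K 0 0 ->
  (forall X Y X' Y', K X Y -> K X' Y' -> K (X + X') (Y + Y')) ->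
  (forall (a : R) X Y, 0 <= a -> K X Y -> K (a%:C *: X) (a%:C *: Y)) ->
  (forall s s' X Y, (forall k, K (s k) (s' k)) ->
    mx_cvg s X -> mx_cvg s' Y -> K X Y) ->
  ~ K V W ->
  exists A B, (forall X Y, K X Y -> 0 <= retr X A + retr Y B) /\
    retr V A + retr W B < 0.
Proof.
move=> K0 KD KZ Kcl KVW.
pose T := (bool * (bool * ('I_n * 'I_n)))%type.
pose dec (b : bool) (w : T -> R) : 'M[C]_n :=
  \matrix_(i, j) (w (b, (true, (i, j))) +i* w (b, (false, (i, j)))).
pose enc (X Y : 'M[C]_n) (t : T) : R :=
  (if t.2.1 then Re else Im) ((if t.1 then X else Y) t.2.2.1 t.2.2.2).
have decK X Y : dec true (enc X Y) = X /\ dec false (enc X Y) = Y.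
  by split; apply/matrixP => i j; rewrite mxE /enc /=; case: (_ i j).
pose K' w := K (dec true w) (dec false w).
have [||||| y [yK yv]] := @cone_separation R T K' (enc V W).
- rewrite /K' (_ : dec true _ = 0) 1?(_ : dec false _ = 0) //;
    by apply/matrixP => i j; rewrite !mxE.
- move=> x x' Kx Kx'; rewrite /K'.
  have decD b : dec b (fun t => x t + x' t) = dec b x + dec b x'.
    by apply/matrixP => i j; rewrite !mxE.
  by rewrite !decD; exact: KD.
- move=> a x a0 Kx; rewrite /K'.
  have decZ b : dec b (fun t => a * x t) = a%:C *: dec b x.
    apply/matrixP => i j; rewrite !mxE; apply/eqP; rewrite eq_complex /=.
    by rewrite !mul0r subr0 addr0 !eqxx.
  by rewrite !decZ; exact: KZ.
- move=> u l uK ul.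
  apply: (Kcl (fun k => dec true (u k)) (fun k => dec false (u k))) => //.
    split=> i j; rewrite mxE; under eq_fun do rewrite mxE; exact: ul.
  split=> i j; rewrite mxE; under eq_fun do rewrite mxE; exact: ul.
- by rewrite /K'; have [-> ->] := decK V W.
(* The transposition and the conjugation undo those in [retrE], so that pairing with [D b] is the
   real dot product with the coordinates of [y]. *)
pose D b : 'M[C]_n :=
  \matrix_(j, i) (y (b, (true, (i, j))) -i* y (b, (false, (i, j)))).
have yE X Y : \sum_t y t * enc X Y t = retr X (D true) + retr Y (D false).
  have sum_pair (U : finType) (f : bool * U -> R) :
      \sum_t f t = \sum_u f (true, u) + \sum_u f (false, u).
    rewrite (eq_bigr (fun p => f (p.1, p.2))) => [|[] //].
    by rewrite -(pair_bigA _ (fun b u => f (b, u))) big_bool.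
  rewrite !sum_pair !retrE -!big_split /=.
  by apply: eq_bigr => -[i j] _; rewrite !mxE /enc /=; ring.
exists (D true), (D false); split=> [X Y KXY|]; rewrite -yE //.
by apply: yK; rewrite /K'; have [-> ->] := decK X Y.
Qed.

End TracePairing.

(** * Bounds on [Omega], the cone of sandwiched pairs, and its dual witnesses *)

Section Discrimination.
Variables (R : realType) (n : nat).
Local Notation C := R[i].
Local Notation Re := (@complex.Re R).
Implicit Types (F : set 'M[C]_n) (rho s X Y A B : 'M[C]_n).

Lemma loewner_le_tr (l : R) X Y :
  is_state X -> is_state Y -> loewner_le X (l%:C *: Y) -> 1 <= l.
Proof.
move=> stX stY /retr_ge0 /(_ (@psd1 R n)).
by rewrite retrDl retrNl retrZl !retr_state1 // mulr1 subr_ge0.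
Qed.

Lemma Rmax_ge1 X Y : is_state X -> is_state Y -> (1 <= Rmax X Y)%E.
Proof.
move=> stX stY; apply: le_ereal_inf_tmp => _ [l lP <-].
by rewrite lee_fin; exact: loewner_le_tr lP.
Qed.

Lemma Omega_ge1 F rho :
  (forall s, F s -> is_state s) -> is_state rho -> (1 <= Omega F rho)%E.
Proof.
move=> Fst strho; apply: le_ereal_inf_tmp => _ [s Fs <-].
have s_st := Fst _ Fs; rewrite -[leLHS]mule1.
by apply: lee_pmul; rewrite ?lee01 ?Rmax_ge1.
Qed.

(** The two factors are bounded by [t] and [c / t]. Comparing traces in the first inequality gives
    [1 <= t], so the division is legitimate. *)
Lemma Omega_le F rho s (t c : R) :
  (forall s, F s -> is_state s) -> is_state rho -> F s ->
  psd (t%:C *: s - rho) -> psd (c%:C *: rho - t%:C *: s) ->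
  (Omega F rho <= c%:E)%E.
Proof.
move=> Fst strho Fs le1 le2; have s_st := Fst _ Fs.
have t1 : 1 <= t by exact: loewner_le_tr le1.
have t0 : 0 < t by lra.
have R1 : (Rmax rho s <= t%:E)%E.
  by apply: ereal_inf_lbound; exists t; [exact: le1 | reflexivity].
have R2 : (Rmax s rho <= (c / t)%:E)%E.
  apply: ereal_inf_lbound; exists (c / t); last reflexivity.
  rewrite /= /loewner_le.
  have tV0 : 0 <= t^-1 by rewrite invr_ge0 ltW.
  have := psdZ tV0 le2; rewrite scalerBr !scalerA -!(rmorphM (real_complex R)).
  rewrite (mulVf (lt0r_neq0 t0)).
  by rewrite scale1r (mulrC t^-1).
have -> : c = t * (c / t) by rewrite mulrC divfK // gt_eqF.
apply: le_trans (_ : _ <= Rmax rho s * Rmax s rho)%E _.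
  by apply: ereal_inf_lbound; exists s.
rewrite EFinM; apply: lee_pmul => //.
  exact: le_trans lee01 (Rmax_ge1 strho s_st).
exact: le_trans lee01 (Rmax_ge1 s_st strho).
Qed.

(** At [(- rho, c rho)] membership reads [rho <= t s <= c rho]. The weight [t] turns the product of
    two [Rmax] values into conditions that are jointly linear in [X], [Y] and [t s]. *)
Definition sandwich_cone F X Y : Prop :=
  exists (t : R) s, [/\ 0 <= t, F s, psd (X + t%:C *: s) & psd (Y - t%:C *: s)].

Lemma sandwich_coneD F X Y X' Y' : convex_set F ->
  sandwich_cone F X Y -> sandwich_cone F X' Y' ->
  sandwich_cone F (X + X') (Y + Y').
Proof.
move=> Fconv [t [s [t0 Fs pX pY]]] [t' [s' [t'0 Fs' pX' pY']]].
suff [s'' Fs'' sE] : exists2 s'', F s'' &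
    (t + t')%:C *: s'' = t%:C *: s + t'%:C *: s'.
  exists (t + t'), s''; rewrite sE opprD (addrACA X) (addrACA Y).
  by split; [exact: addr_ge0 | exact: Fs'' | exact: psdD pX pX' | exact: psdD pY pY'].
(* The normalised weights [t / (t + t')] need a nonzero total; when it vanishes both weights do, and
   any free state serves. *)
have [tt0|tt0] := eqVneq (t + t') 0.
  have [-> ->] : t = 0 /\ t' = 0 by split; lra.
  by exists s; rewrite // addr0 !scale0r addr0.
have tt_gt0 : 0 < t + t' by rewrite lt_def tt0 addr_ge0.
exists ((t / (t + t'))%:C *: s + (1 - t / (t + t'))%:C *: s').
  apply: Fconv => //; first by rewrite divr_ge0 // ltW.
  by rewrite ler_pdivrMr // mul1r lerDl.
rewrite scalerDr !scalerA -!rmorphM /=; congr (_%:C *: _ + _%:C *: _); field.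
  exact: tt0.
exact: tt0.
Qed.

Lemma sandwich_coneZ F (a : R) X Y : 0 <= a ->
  sandwich_cone F X Y -> sandwich_cone F (a%:C *: X) (a%:C *: Y).
Proof.
move=> a0 [t [s [t0 Fs pX pY]]]; exists (a * t), s.
rewrite (rmorphM (real_complex R)) -scalerA -scalerDr -scalerBr.
by split; [exact: mulr_ge0 | exact: Fs | exact: psdZ a0 pX | exact: psdZ a0 pY].
Qed.

(* The trace of [Y] bounds the weight [t], so the decompositions of a convergent
   sequence stay in a compact set. *)
Lemma sandwich_cone_closed F (x y : nat -> 'M[C]_n) X Y :
  (forall s, F s -> is_state s) -> closed_set F ->
  (forall k, sandwich_cone F (x k) (y k)) -> mx_cvg x X -> mx_cvg y Y ->
  sandwich_cone F X Y.
Proof.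
move=> Fst Fcl.
(* Dropping finitely many terms makes the bound on the trace of [y k] hold for every index. *)
wlog tr_bound : x y / forall k, retr (y k) 1%:M <= retr Y 1%:M + 1.
  move=> hwlog xyF xX yY.
  have /cvgrPdist_lt /(_ 1 ltr01) [N _ yN] := retr_cvg (A := 1%:M) yY.
  have kN k : (k <= k + N)%N by exact: leq_addr.
  apply: (hwlog (fun k => x (k + N)%N) (fun k => y (k + N)%N)) => [k|k||].
  - have := yN (k + N)%N; rewrite /= leq_addl => /(_ isT).
    by rewrite ltr_norml => /andP[+ _]; lra.
  - exact: xyF.
  - exact: mx_cvg_subseq xX.
  - exact: mx_cvg_subseq yY.
move=> xyF xX yY.
have [t /choice [s tsP]] := choice xyF.
have t_bound k : `|t k| <= retr Y 1%:M + 1.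
  have [t0 Fs _ /retr_ge0 /(_ (@psd1 R n))] := tsP k.
  rewrite retrDl retrNl retrZl (retr_state1 (Fst _ Fs)) mulr1 subr_ge0.
  by rewrite ger0_norm // => /le_trans; exact.
have [phi [l [kphi tl]]] :=
  @bounded_cvg_subseq _ unit (fun k _ => t k) _ (fun k _ => t_bound k).
have [|psi [s0 [kpsi ss0]]] := @states_cvg_subseq R n (fun k => s (phi k)).
  by move=> k; apply: Fst; have [] := tsP (phi k).
have {}tl : t (phi (psi k)) @[k --> \oo] --> l tt.
  exact: (@cvg_subseq R (fun k => t (phi k))) kpsi (tl tt).
have kpp k : (k <= phi (psi k))%N by exact: leq_trans (kpsi k) (kphi _).
have ts_cvg := mx_cvgZ tl ss0.
exists (l tt), s0; split.
- by apply: cvgr_to_ge tl _; apply: nearW => k; have [] := tsP (phi (psi k)).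
- have [sRe sIm] := ss0; apply: Fcl sRe sIm => k.
  by have [] := tsP (phi (psi k)).
- apply: psd_closed (mx_cvgD (mx_cvg_subseq kpp xX) ts_cvg) => k.
  by have [] := tsP (phi (psi k)).
- apply: psd_closed (mx_cvgD (mx_cvg_subseq kpp yY) (mx_cvgN ts_cvg)) => k.
  by have [] := tsP (phi (psi k)).
Qed.

(** The separating functional is tested on [(P, 0)] and [(0, P)] for positivity of the two matrices,
    and on [(- s, s)] for the inequality on free states; its strict sign at [(- rho, c rho)] is the
    last claim. *)
Lemma Omega_dual_witness F rho (c : R) :
  free_set F -> is_state rho -> (c%:E < Omega F rho)%E ->
  exists A B, [/\ psd A, psd B,
    (forall s, F s -> retr s A <= retr s B) & c * retr rho B < retr rho A].
Proof.
move=> [Fst [Fconv [Fcl [s1 Fs1]]]] strho cOmega.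
have notK : ~ sandwich_cone F (- rho) (c%:C *: rho).
  move=> [t [s [t0 Fs p1 p2]]]; move: cOmega; apply/negP; rewrite -leNgt.
  by apply: Omega_le Fs _ p2; rewrite // addrC.
have psdK P : psd P -> sandwich_cone F P 0 /\ sandwich_cone F 0 P.
  move=> pP; split; exists 0, s1; rewrite scale0r ?addr0 ?subr0;
    by split=> //; exact: psd0.
have [||||A0 [B0 [AB_ge0 AB_lt0]]] := mx_cone_separation _ _ _ _ notK.
- by have [] := psdK 0 (@psd0 R n).
- by move=> *; exact: sandwich_coneD.
- by move=> *; exact: sandwich_coneZ.
- by move=> *; exact: sandwich_cone_closed.
have retr0l A : retr 0 A = 0 by rewrite /retr mul0mx mxtrace0.
have [P /psdK[/AB_ge0 + _]|A [pA AE]] := @hermitian_part R n A0.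
  by rewrite retr0l addr0.
have [P /psdK[_ /AB_ge0]|B [pB BE]] := @hermitian_part R n B0.
  by rewrite retr0l add0r.
exists A, B; split=> // [s Fs|].
  have [ps _] := Fst _ Fs.
  have /AB_ge0 : sandwich_cone F (- s) s.
    exists 1, s; rewrite scale1r addNr subrr; split=> //; exact: psd0.
  by rewrite retrNl AE // BE //; lra.
have [prho _] := strho; move: AB_lt0; rewrite retrNl retrZl AE // BE //; lra.
Qed.

(** The free set is sequentially compact, and the ratio is continuous on it because its denominator
    is positive there. The maximum has to be attained for a ratio to be well defined. *)
Lemma ratio_max_attained F A B :
  free_set F -> (forall s, F s -> 0 < retr s B) ->
  (forall s, F s -> retr s A <= retr s B) ->
  exists2 s0, F s0 & forall s, F s -> retr s A / retr s B <= retr s0 A / retr s0 B.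
Proof.
move=> [Fst [_ [Fcl [s1 Fs1]]]] B_gt0 AB.
pose r s := retr s A / retr s B.
pose S : set R := [set r s | s in F].
have S_sup : has_sup S.
  split; first by exists (r s1), s1.
  exists 1 => _ [s Fs <-]; rewrite /r ler_pdivrMr ?mul1r; [exact: AB | exact: B_gt0].
have near_sup k : exists s, F s /\ sup S - k.+1%:R^-1 < r s.
  have k_gt0 : 0 < k.+1%:R^-1 :> R by rewrite invr_gt0.
  by have [_ [s Fs <-] slt] := sup_adherent k_gt0 S_sup; exists s.
have [u uP] := choice near_sup.
have [|phi [s0 [kphi us0]]] := @states_cvg_subseq R n u.
  by move=> k; apply: Fst; have [] := uP k.
have Fs0 : F s0.
  by have [uRe uIm] := us0; apply: Fcl uRe uIm => k; have [] := uP (phi k).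
exists s0 => // s Fs; apply: (@le_trans _ _ (sup S)).
  by apply: sup_upper_bound => //; exists s.
have r_cvg : r (u (phi k)) @[k --> \oo] --> r s0.
  apply: cvgM; first exact: retr_cvg.
  by apply: cvgV; [rewrite gt_eqF // B_gt0 | exact: retr_cvg].
have b_cvg : sup S - k.+1%:R^-1 @[k --> \oo] --> sup S - 0.
  by apply: cvgB; [exact: cvg_cst | exact: cvg_harmonic].
rewrite -[leLHS]subr0; apply: ler_cvg_to b_cvg r_cvg _.
apply: nearW => k; have [_ /ltW uk] := uP (phi k).
apply: le_trans uk; rewrite lerD2l lerN2 lef_pV2 ?posrE ?ltr0n //.
by rewrite ler_nat ltnS.
Qed.

(** * Success probabilities and the upper bound on the ratios *)

Lemma channel_psd m (N : 'M[C]_n -> 'M[C]_m) X :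
  is_channel N -> psd X -> psd (N X).
Proof.
move=> [_ [Ncp _]] pX v.
have /Ncp /(_ (fun=> v)) : block_psd (fun _ _ : 'I_1 => X).
  by move=> w; rewrite !big_ord1; exact: pX.
by rewrite !big_ord1.
Qed.

Lemma channel_id : is_channel (@id 'M[C]_n).
Proof. by split=> [a X Y //|]; split=> [k X //|X]. Qed.

Lemma psuccE m k X (p : 'I_k -> R) (N : 'I_k -> 'M[C]_n -> 'M[C]_m)
    (A : 'I_k -> 'M[C]_m) :
  psucc X p N A = \sum_i p i * retr (N i X) (A i).
Proof. by []. Qed.

Lemma psucc_ge0 m k X (p : 'I_k -> R) (N : 'I_k -> 'M[C]_n -> 'M[C]_m)
    (A : 'I_k -> 'M[C]_m) :
  is_prob p -> (forall i, is_channel (N i)) -> is_POVM A -> psd X ->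
  0 <= psucc X p N A.
Proof.
move=> [p0 _] Nch [pA _] pX; rewrite psuccE; apply: sumr_ge0 => i _.
apply: mulr_ge0; first exact: p0.
exact: retr_ge0 (channel_psd (Nch i) pX) (pA i).
Qed.

(** The success probability is linear in its input and nonnegative at the positive matrix
    [l Y - X]. *)
Lemma psucc_mono m k (l : R) X Y (p : 'I_k -> R)
    (N : 'I_k -> 'M[C]_n -> 'M[C]_m)
    (A : 'I_k -> 'M[C]_m) :
  is_prob p -> (forall i, is_channel (N i)) -> is_POVM A ->
  loewner_le X (l%:C *: Y) -> psucc X p N A <= l * psucc Y p N A.
Proof.
move=> pp Nch AA /(psucc_ge0 pp Nch AA); rewrite !psuccE => H.
rewrite -subr_ge0 mulr_sumr -sumrB; apply: le_trans H _.
apply: ler_sum => i _; have [Nlin _] := Nch i.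
rewrite (_ : l%:C *: Y - X = (-1) *: X + l%:C *: Y); last first.
  by rewrite scaleN1r addrC.
have N0 : N i 0 = 0.
  have := Nlin 1 0 0; rewrite !scale1r addr0 => /eqP.
  by rewrite -subr_eq0 opprD addrA subrr sub0r oppr_eq0 => /eqP.
have NlY : N i (l%:C *: Y) = l%:C *: N i Y.
  by have := Nlin l%:C Y 0; rewrite N0 !addr0.
rewrite Nlin NlY scaleN1r retrDl retrNl retrZl mulrDr mulrN addrC mulrCA.
exact: lexx.
Qed.

Lemma discrimination_ratio_le F rho (x l mu : R) s :
  (forall s, F s -> is_state s) -> is_state rho ->
  discrimination_ratios F rho x -> F s ->
  loewner_le rho (l%:C *: s) -> loewner_le s (mu%:C *: rho) -> x <= l * mu.
Proof.
move=> Fst strho.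
move=> [m [k [p [N [A [B [pp Nch AA BB [rB0 FB0]]]]]]]].
move=> [s0 [Fs0 s0max]] [rs0 ->] Fs le1 le2.
have s_st := Fst _ Fs.
have l1 : 1 <= l by exact: loewner_le_tr le1.
have mu1 : 1 <= mu by exact: loewner_le_tr le2.
have aA := psucc_mono pp Nch AA le1.
have bB := psucc_mono pp Nch BB le2.
have psucc_pos Z w : is_POVM Z -> is_state w -> 0 <= psucc w p N Z.
  by move=> ZZ [pw _]; exact: psucc_ge0.
have b_gt0 : 0 < psucc rho p N B by rewrite lt_def rB0 psucc_pos.
have b'_gt0 : 0 < psucc s p N B by rewrite lt_def (FB0 _ Fs) (psucc_pos _ _ BB s_st).
have a'_ge0 : 0 <= psucc s p N A by exact: psucc_pos.
(* Well-definedness only says that the maximum is nonzero; with nonnegativity it is positive, so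
   dividing by it preserves the order. *)
have r_gt0 : 0 < psucc s0 p N A / psucc s0 p N B.
  have s0_st := Fst _ Fs0; rewrite lt_def rs0.
  by apply: divr_ge0; [exact: psucc_pos AA s0_st | exact: psucc_pos BB s0_st].
rewrite ler_pdivrMr //.
apply: le_trans (_ : _ <= l * mu * (psucc s p N A / psucc s p N B)) _; last first.
  apply: ler_wpM2l (s0max s Fs).
  exact: mulr_ge0 (le_trans ler01 l1) (le_trans ler01 mu1).
move: aA bB b_gt0 b'_gt0 a'_ge0; clear -l1 mu1.
move: (psucc rho p N A) (psucc rho p N B) (psucc s p N A) (psucc s p N B).
move=> a b a' b' aA bB b0 b'0 a'0.
rewrite ler_pdivrMr // mulrA -(mulrAC _ b) ler_pdivlMr //.
have step1 : a * b' <= l * a' * b' by apply: ler_wpM2r aA; exact: ltW.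
have step2 : l * a' * b' <= l * a' * (mu * b).
  by apply: ler_wpM2l bB; apply: mulr_ge0 a'0; lra.
lra.
Qed.

(** The maximal ratio over the free set lies in [(0, 1]], so dividing by it cannot decrease the
    ratio at [rho]. *)
Lemma binary_discrimination F rho A B :
  free_set F -> is_state rho ->
  psd A -> psd (1%:M - A) -> psd B -> psd (1%:M - B) -> 0 < retr rho B ->
  (forall s, F s -> 0 < retr s A) -> (forall s, F s -> retr s A <= retr s B) ->
  exists2 x, discrimination_ratios F rho x & retr rho A / retr rho B <= x.
Proof.
move=> Ffree strho pA pA' pB pB' rhoB A_gt0 AB.
have B_gt0 s : F s -> 0 < retr s B.
  by move=> Fs; apply: lt_le_trans (AB _ Fs); exact: A_gt0.
have [s0 Fs0 s0max] := ratio_max_attained Ffree B_gt0 AB.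
(* All prior weight sits on outcome [0], so the success probability is [retr w Z]; the effect
   [1%:M - Z] only completes the measurement. *)
pose p (i : 'I_2) : R := (i == ord0)%:R.
pose E (Z : 'M[C]_n) (i : 'I_2) := if i == ord0 then Z else 1%:M - Z.
have E_POVM Z : psd Z -> psd (1%:M - Z) -> is_POVM (E Z).
  move=> pZ pZ'; split=> [i|]; first by rewrite /E; case: (i == ord0).
  by rewrite big_ord_recl big_ord1 /E /= addrC subrK.
have psucc_E w Z : psucc w p (fun=> id) (E Z) = retr w Z.
  by rewrite psuccE big_ord_recl big_ord1 /E /p /= mul1r mul0r addr0.
have r0 : 0 < retr s0 A / retr s0 B.
  by rewrite divr_gt0 ?A_gt0 ?B_gt0.
have r1 : retr s0 A / retr s0 B <= 1.
  by rewrite ler_pdivrMr ?mul1r; [exact: AB | exact: B_gt0].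
exists ((retr rho A / retr rho B) / (retr s0 A / retr s0 B)).
  exists n, 2%N, p, (fun=> id), (E A), (E B); split.
  - split=> [i|]; first exact: ler0n.
    by rewrite big_ord_recl big_ord1 /p /= addr0.
  - by move=> i; exact: channel_id.
  - exact: E_POVM.
  - exact: E_POVM.
  - rewrite /= !psucc_E; split; first by rewrite gt_eqF.
    + by move=> s Fs; rewrite psucc_E gt_eqF // B_gt0.
    + exists s0; last by rewrite !psucc_E gt_eqF.
      by split=> // s Fs; rewrite !psucc_E; exact: s0max.
rewrite ler_pdivlMr //; apply: ler_piMr => //.
have [prho _] := strho.
by apply: divr_ge0; [exact: retr_ge0 | exact: ltW].
Qed.

(** The quadratic form at [v] is the trace of [A] against a rank-one matrix, bounded in [psd_tr_mul]
    by [\tr A] times the squared norm of [v]. *)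
Lemma psd_le_tr (L : R) A : psd A -> Re (\tr A) <= L -> psd (L%:C%:M - A).
Proof.
move=> pA trL v.
have /andP[_] := psd_tr_mul (psd_outer v) pA.
have trA : \tr A <= L%:C.
  by have := psd_tr_ge0 pA; rewrite ge0cE lecE /= eq_sym => /andP[-> _].
have vv : 0 <= \tr (v *m adj v) by exact: psd_tr_ge0 (psd_outer v).
rewrite mulmxBr mulmxBl mxE [X in _ + X]mxE subr_ge0 quad_tr mxtrace_mulC.
move=> /le_trans; apply; rewrite mul_mx_scalar -scalemxAl mxE mulrC.
by rewrite -[(adj v *m v) 0 0]trace_mx11 [\tr (adj v *m v)]mxtrace_mulC ler_wpM2r.
Qed.

Lemma discrimination_ratio_gt F rho (c : R) :
  free_set F -> is_state rho -> (c%:E < Omega F rho)%E ->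
  exists2 x, discrimination_ratios F rho x & c < x.
Proof.
move=> Ffree strho cOmega.
have [A [B [pA pB AB cAB]]] := Omega_dual_witness Ffree strho cOmega.
have [Fst _] := Ffree.
pose g := retr rho A - c * retr rho B.
have g0 : 0 < g by rewrite /g subr_gt0.
have c1 : 0 < `|c| + 1 by rewrite ltr_wpDl.
(* The shift [e] is small enough for the gap [g] to survive: [e * c <= g - e < g + e], which is the
   strict inequality for the shifted matrices. *)
pose e := g / (`|c| + 1).
have e0 : 0 < e by rewrite divr_gt0.
have eg : e * (`|c| + 1) = g by rewrite /e divfK // gt_eqF.
have ecg : e * c < g + e.
  apply: le_lt_trans (_ : e * `|c| < _); first by rewrite ler_pM2l // ler_norm.
  by rewrite -eg mulrDr mulr1 -addrA ltrDl addr_gt0.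
have shift_psd (Z : 'M[C]_n) : psd Z -> psd (Z + e%:C *: 1%:M).
  by move=> pZ; exact: psdD pZ (psdZ (ltW e0) (@psd1 R n)).
(* The shift makes both pairings positive on every state. Dividing by [L], which exceeds both
   traces, turns the matrices into effects and cancels in the ratio. *)
pose A1 := A + e%:C *: 1%:M; pose B1 := B + e%:C *: 1%:M.
pose L := Re (\tr A1) + Re (\tr B1) + 1.
have tr_ge0 (Z : 'M[C]_n) : psd Z -> 0 <= Re (\tr Z).
  by move=> /psd_tr_ge0; rewrite ge0cE => /andP[].
have trA := tr_ge0 _ (shift_psd _ pA); have trB := tr_ge0 _ (shift_psd _ pB).
rewrite -/A1 in trA; rewrite -/B1 in trB.
have L0 : 0 < L by rewrite /L; lra.
have LV0 : 0 < L^-1 by rewrite invr_gt0.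
have effect (Z : 'M[C]_n) : psd Z -> Re (\tr Z) <= L -> psd (1%:M - L^-1%:C *: Z).
  move=> pZ trZ; have := psdZ (ltW LV0) (psd_le_tr pZ trZ).
  rewrite scalerBr scale_scalar_mx -(rmorphM (real_complex R)).
  by rewrite (mulVf (lt0r_neq0 L0)).
have retr_shift s (Z : 'M[C]_n) : is_state s ->
    retr s (L^-1%:C *: (Z + e%:C *: 1%:M)) = L^-1 * (retr s Z + e).
  by move=> st_s; rewrite retrZr retrDr retrZr retr_state1 // mulr1.
have retr_gt0 s (Z : 'M[C]_n) : is_state s -> psd Z -> 0 < L^-1 * (retr s Z + e).
  move=> [ps _] pZ; rewrite mulr_gt0 // ltr_wpDl //; exact: retr_ge0.
have [||||||| x xF rx] := @binary_discrimination F rho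
  (L^-1%:C *: A1) (L^-1%:C *: B1) Ffree strho.
- exact: psdZ (ltW LV0) (shift_psd _ pA).
- by apply: effect (shift_psd _ pA) _; rewrite -/A1 /L; lra.
- exact: psdZ (ltW LV0) (shift_psd _ pB).
- by apply: effect (shift_psd _ pB) _; rewrite -/B1 /L; lra.
- by rewrite retr_shift //; exact: retr_gt0.
- by move=> s Fs; rewrite retr_shift; [apply: retr_gt0 => // |]; exact: Fst.
- move=> s Fs; have st_s := Fst _ Fs; rewrite !retr_shift //.
  by rewrite ler_pM2l // lerD2r; exact: AB.
exists x; first exact: xF.
apply: lt_le_trans rx; rewrite !retr_shift // ltr_pdivlMr; last exact: retr_gt0.
rewrite mulrCA ltr_pM2l // mulrDr; move: ecg; rewrite /g; lra.
Qed.

End Discrimination.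

(** * The two inequalities in the extended reals *)

Theorem theorem10 (R : realType) (n : nat) (F : set 'M[R[i]]_n)
    (rho : 'M[R[i]]_n) :
  free_set F -> is_state rho ->
  ereal_sup [set (x%:E)%E | x in discrimination_ratios F rho] = Omega F rho.
Proof.
move=> Ffree strho; have [Fst _] := Ffree.
apply/eqP; rewrite eq_le; apply/andP; split.
  apply: ge_ereal_sup => _ [x xF <-]; apply: le_ereal_inf_tmp => _ [s Fs <-].
  have s_st := Fst _ Fs.
  have l_ge1 := Rmax_ge1 strho s_st; have mu_ge1 := Rmax_ge1 s_st strho.
  have x_le l mu := @discrimination_ratio_le R n F rho x l mu s Fst strho xF Fs.
  (* The infima are taken one factor at a time: with [mu] fixed and positive, dividing by it leaves
     a lower bound for the first [Rmax]. *)
  have x_le_Rmax mu : loewner_le s (mu%:C%C *: rho) -> (x%:E <= Rmax rho s * mu%:E)%E.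
    move=> le_mu; have mu_gt0 : 0 < mu.
      exact: lt_le_trans ltr01 (loewner_le_tr s_st strho le_mu).
    rewrite muleC -(lee_pdivrMl _ _ mu_gt0); apply: le_ereal_inf_tmp => _ [l le_l <-].
    by rewrite -EFinM lee_fin mulrC (ler_pdivrMr _ _ mu_gt0); exact: x_le le_l le_mu.
  (* If the first factor is infinite the product is too, since the second is at least [1]; otherwise
     it is positive and can be divided out. *)
  case Rl : (Rmax rho s) l_ge1 => [l| |] // l_ge1; last first.
    by rewrite gt0_mulye ?leey //; exact: lt_le_trans lte01 mu_ge1.
  have l_gt0 : 0 < l by move: l_ge1; rewrite lee_fin; exact: lt_le_trans.
  rewrite -(lee_pdivrMl _ _ l_gt0); apply: le_ereal_inf_tmp => _ [mu le_mu <-].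
  by rewrite (lee_pdivrMl _ _ l_gt0) -Rl; exact: x_le_Rmax le_mu.
have Omega1 := Omega_ge1 Fst strho.
have sup_gt c : (c%:E < Omega F rho)%E ->
    (c%:E < ereal_sup [set (x%:E)%E | x in discrimination_ratios F rho])%E.
  move=> /(discrimination_ratio_gt Ffree strho)[x xF cx].
  apply: lt_le_trans (_ : x%:E <= _)%E; first by rewrite lte_fin.
  by apply: ereal_sup_ubound; exists x.
rewrite leNgt; apply/negP.
(* A finite supremum below [Omega F rho] would exceed itself by [sup_gt]; the value [-oo] (empty set
   of ratios) is excluded by [0 < 1 <= Omega F rho]. *)
case supE : (ereal_sup _) => [c| |] sup_lt.
- by have := sup_gt c sup_lt; rewrite supE ltxx.
- by rewrite ltNge leey in sup_lt.
- by have := sup_gt 0 (lt_le_trans lte01 Omega1); rewrite supE.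
Qed.
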